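(* Let $A$ be a commutative associative $\mathbb C$-algebra and $\Delta$ a nonzero finite-dimensional $\mathbb C$-vector space of commuting $\mathbb C$-derivations of $A$, with basis $\partial_1,\dots,\partial_n$; let $\mathcal W_n(A,\Delta)$ be the generalized Witt algebra, with anchor $\alpha$, and let $H:\mathcal W_n(A,\Delta)\to\mathfrak{gl}_n\otimes A$ be the crossed homomorphism $$H\Big(\sum_{i=1}^na_i\partial_i\Big)=\sum_{i=1}^n\sum_{j=1}^nE_{ij}\otimes\partial_i(a_j),\quad a_i\in A.$$ Then there is a functor $F_H^A:\mathsf{Rep}_{\mathbb C}(\mathfrak{gl}_n)\to\mathsf{WRep}_{\mathbb C}(\mathcal W_n(A,\Delta))$ defined by $$F_H^A(V;\theta)=(V\otimes_{\mathbb C}A;(\alpha\boxplus\theta)\circ\iota_H),\quad\forall(V;\theta)\in\mathsf{Rep}_{\mathbb C}(\mathfrak{gl}_n),$$ and by $\psi\mapsto\psi\otimes\mathrm{Id}_A$ on morphisms.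
   Context: $\mathcal W_n(A,\Delta)$ is the space $A\Delta=A\otimes_{\mathbb C}\Delta$ (free over $A$ with basis $\partial_1,\dots,\partial_n$; write $a\partial$ for $a\otimes\partial$), with Lie bracket $[a\partial,b\delta]=a\partial(b)\delta-b\delta(a)\partial$ for $a,b\in A$, $\partial,\delta\in\Delta$. With $\alpha:A\Delta\to\mathrm{Der}_{\mathbb C}(A)$, $\alpha(a\partial)(x)=a\partial(x)$, it is a Lie-Rinehart algebra over $A$. A Lie-Rinehart algebra $(A,\mathcal L,[\cdot,\cdot],\alpha)$ is a Lie algebra $\mathcal L$ with an $A$-module structure and a map $\alpha:\mathcal L\to\mathrm{Der}_{\mathbb C}(A)$ that is a Lie algebra and $A$-module homomorphism, with $[x,ay]=a[x,y]+\alpha(x)(a)y$. A weak representation $(M;\rho)$ of $\mathcal L$ is an $A$-module $M$ with a $\mathbb C$-Lie algebra homomorphism $\rho:\mathcal L\to\mathfrak{gl}_{\mathbb C}(M)$ such that $\rho(x)(am)=a\rho(x)m+\alpha(x)(a)m$; morphisms in $\mathsf{WRep}_{\mathbb C}(\mathcal L)$ are $A$-module homomorphisms commuting with the actions of $\mathcal L$. $\mathsf{Rep}_{\mathbb C}(\mathfrak{gl}_n)$ is the category of representations of the Lie algebra $\mathfrak{gl}_n$ of complex $n\times n$ matrices; $E_{ij}$ are the matrix units. $\mathfrak{gl}_n\otimes A$ has bracket $[g\otimes a,h\otimes b]=[g,h]\otimes ab$; $\mathcal L=\mathcal W_n(A,\Delta)$ acts on it by $\alpha(x)(g\otimes a)=g\otimes\alpha(x)(a)$,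 and a crossed homomorphism is a linear map $H$ with $H[x,y]=\alpha(x)(Hy)-\alpha(y)(Hx)+[Hx,Hy]$. $\iota_H:\mathcal L\to\mathcal L\ltimes_\alpha(\mathfrak{gl}_n\otimes A)$, $\iota_H(x)=(x,Hx)$, where $\mathcal L\ltimes_\alpha(\mathfrak{gl}_n\otimes A)$ is the semidirect product Lie algebra. $V\otimes_{\mathbb C}A$ has $A$-module structure $a(v\otimes b)=v\otimes ab$, and $(\alpha\boxplus\theta)(x,g\otimes a)(v\otimes b)=v\otimes\alpha(x)(b)+\theta(g)v\otimes ab$. *)

(* Defs.v *)
From HB Require Import structures.
From mathcomp Require Import all_boot all_order all_algebra.
From mathcomp Require Import boolp classical_sets functions.
From mathcomp Require Import ring.

Set Implicit Arguments.
Unset Strict Implicit.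
Unset Printing Implicit Defensive.

Import GRing.Theory.
Local Open Scope ring_scope.
Local Open Scope quotient_scope.

(* -------------------------------------------------------------------- *)
Section LinearMaps.
Variables (K : fieldType).
Implicit Types U V W : lmodType K.

Definition bilinear_map U V W (f : U -> V -> W) : Prop :=
  (forall u, linear (f u)) /\ (forall v, linear (f^~ v)).

Lemma lin0 U V (f : U -> V) : linear f -> f 0 = 0.
Proof.
move=> lf; have := lf (-1) 0 0.
by rewrite scaleN1r oppr0 add0r scaleN1r addNr.
Qed.

Lemma linD U V (f : U -> V) : linear f -> {morph f : x y / x + y}.
Proof. by move=> lf x y; have := lf 1 x y; rewrite !scale1r. Qed.

Lemma linZ U V (f : U -> V) : linear f -> forall k, {morph f : x / k *: x}.
Proof. by move=> lf k x; have := lf k x 0; rewrite !addr0 (lin0 lf) addr0. Qed.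

Lemma linN U V (f : U -> V) : linear f -> {morph f : x / - x}.
Proof. by move=> lf x; rewrite -scaleN1r (linZ lf) scaleN1r. Qed.

Lemma linB U V (f : U -> V) : linear f -> {morph f : x y / x - y}.
Proof. by move=> lf x y; rewrite (linD lf) (linN lf). Qed.

Lemma lin_sum U V (f : U -> V) (lf : linear f) (I : Type) (r : seq I)
    (P : pred I) (F : I -> U) :
  f (\sum_(i <- r | P i) F i) = \sum_(i <- r | P i) f (F i).
Proof. exact: (big_morph f (linD lf) (lin0 lf)). Qed.

Lemma linP U V (f : U -> V) :
  {morph f : x y / x + y} -> (forall k, {morph f : x / k *: x}) -> linear f.
Proof. by move=> fD fZ k x y; rewrite fD fZ. Qed.

End LinearMaps.

(* -------------------------------------------------------------------- *)
(* U (x)_K V, as formal sums of pairs modulo the congruence generated by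
   the bilinearity relations.  Lemmas tlift_linear, tliftE and tens_eq below
   give its universal property. *)
Section Tensor.
Variables (K : fieldType) (U V : lmodType K).

Inductive tensor_eqv : seq (U * V) -> seq (U * V) -> Prop :=
| teqv_refl s : tensor_eqv s s
| teqv_sym s t : tensor_eqv s t -> tensor_eqv t s
| teqv_trans s t r : tensor_eqv s t -> tensor_eqv t r -> tensor_eqv s r
| teqv_cat s s' t t' :
    tensor_eqv s s' -> tensor_eqv t t' -> tensor_eqv (s ++ t) (s' ++ t')
| teqv_comm s t : tensor_eqv (s ++ t) (t ++ s)
| teqv_zero v : tensor_eqv [:: (0, v)] [::]
| teqv_addl u u' v : tensor_eqv [:: (u + u', v)] [:: (u, v); (u', v)]
| teqv_addr u v v' : tensor_eqv [:: (u, v + v')] [:: (u, v); (u, v')]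
| teqv_scale k u v : tensor_eqv [:: (k *: u, v)] [:: (u, k *: v)].

Definition tensor_eqvb : rel (seq (U * V)) := fun s t => `[< tensor_eqv s t >].

Lemma tensor_eqvb_refl : reflexive tensor_eqvb.
Proof. by move=> s; apply/asboolP; exact: teqv_refl. Qed.

Lemma tensor_eqvb_sym : symmetric tensor_eqvb.
Proof. by move=> s t; apply/asboolP/asboolP; exact: teqv_sym. Qed.

Lemma tensor_eqvb_trans : transitive tensor_eqvb.
Proof.
by move=> t s r /asboolP st /asboolP tr; apply/asboolP; exact: teqv_trans tr.
Qed.

Canonical tensor_equiv :=
  EquivRel tensor_eqvb tensor_eqvb_refl tensor_eqvb_sym tensor_eqvb_trans.

Definition tensor : Type := {eq_quot tensor_equiv}.
HB.instance Definition _ := Choice.copy tensor {eq_quot tensor_equiv}.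
HB.instance Definition _ := EqQuotient.copy tensor {eq_quot tensor_equiv}.

Lemma tensor_piP s t : tensor_eqv s t -> \pi_tensor s = \pi_tensor t.
Proof. by move=> st; apply/eqmodP/asboolP. Qed.

Lemma tensor_reprP s : tensor_eqv (repr (\pi_tensor s)) s.
Proof.
apply/asboolP; rewrite -[`[< _ >]]/(tensor_equiv _ _).
by apply/eqmodP; rewrite reprK.
Qed.

Definition tadd (x y : tensor) : tensor := \pi_tensor (repr x ++ repr y).
Definition tscale (k : K) (x : tensor) : tensor :=
  \pi_tensor (map (fun p => (k *: p.1, p.2)) (repr x)).

Lemma tadd_pi s t : tadd (\pi_tensor s) (\pi_tensor t) = \pi_tensor (s ++ t).
Proof. by apply/tensor_piP/teqv_cat; exact: tensor_reprP. Qed.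

Let sc k := map (fun p : U * V => (k *: p.1, p.2)).

Lemma sc_eqv k s t : tensor_eqv s t -> tensor_eqv (sc k s) (sc k t).
Proof.
elim=> {s t} [s|s t _|s t r _ + _|s s' t t' _ + _|s t|v|u u' v|u v v'|c u v].
- exact: teqv_refl.
- exact: teqv_sym.
- exact: teqv_trans.
- by rewrite /sc !map_cat; exact: teqv_cat.
- by rewrite /sc !map_cat; exact: teqv_comm.
- by rewrite /= scaler0; exact: teqv_zero.
- by rewrite /= scalerDr; exact: teqv_addl.
- exact: teqv_addr.
- by rewrite /= scalerA mulrC -scalerA; exact: teqv_scale.
Qed.

Lemma tscale_pi k s : tscale k (\pi_tensor s) = \pi_tensor (sc k s).
Proof. by apply/tensor_piP/sc_eqv; exact: tensor_reprP. Qed.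

Lemma tensor_piK (P : tensor -> Prop) : (forall s, P (\pi_tensor s)) -> forall t, P t.
Proof. by move=> Ps t; rewrite -[t]reprK. Qed.

Let taddA : associative tadd.
Proof.
elim/tensor_piK=> s; elim/tensor_piK=> t; elim/tensor_piK=> r.
by rewrite !tadd_pi catA.
Qed.

Let taddC : commutative tadd.
Proof.
elim/tensor_piK=> s; elim/tensor_piK=> t.
by rewrite !tadd_pi; exact/tensor_piP/teqv_comm.
Qed.

Let tadd0 : left_id (\pi_tensor [::]) tadd.
Proof. by elim/tensor_piK=> s; rewrite tadd_pi. Qed.

Let sc_cat k l s : tensor_eqv (sc (k + l) s) (sc k s ++ sc l s).
Proof.
elim: s => [|[u v] s IHs] /=; first exact: teqv_refl.
rewrite scalerDl -cat1s.
apply: teqv_trans (teqv_cat (teqv_addl _ _ _) IHs) _.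
rewrite /= -[X in tensor_eqv X _]cat1s -[X in tensor_eqv _ X]cat1s.
apply: teqv_cat; first exact: teqv_refl.
rewrite -[X in tensor_eqv X _]cat1s catA -[X in tensor_eqv _ (_ ++ X)]cat1s.
rewrite [X in tensor_eqv _ X]catA.
by apply: teqv_cat; [exact: teqv_comm|exact: teqv_refl].
Qed.

Let sc0 s : tensor_eqv (sc 0 s) [::].
Proof.
elim: s => [|[u v] s IHs] /=; first exact: teqv_refl.
rewrite scale0r -cat1s -[X in tensor_eqv _ X]cats0.
by apply: teqv_cat; first exact: teqv_zero.
Qed.

Let sc1 s : sc 1 s = s.
Proof. by elim: s => //= [[u v] s ->]; rewrite scale1r. Qed.

Let taddN : left_inverse (\pi_tensor [::]) (tscale (-1)) tadd.
Proof.
elim/tensor_piK=> s; rewrite tscale_pi tadd_pi; apply: tensor_piP.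
rewrite -{2}[s]sc1; apply: teqv_trans (teqv_sym (sc_cat _ _ _)) _.
by rewrite addNr; exact: sc0.
Qed.

HB.instance Definition _ := GRing.isZmodule.Build tensor taddA taddC tadd0 taddN.

Let tscaleA k l x : tscale k (tscale l x) = tscale (k * l) x.
Proof.
elim/tensor_piK: x => s; rewrite !tscale_pi; congr (\pi_tensor _).
by rewrite /sc -map_comp; apply: eq_map => p /=; rewrite scalerA.
Qed.

Let tscale1 : left_id 1 tscale.
Proof. by elim/tensor_piK=> s; rewrite tscale_pi sc1. Qed.

Let tscaleDr : right_distributive tscale +%R.
Proof.
move=> k; elim/tensor_piK=> s; elim/tensor_piK=> t.
by rewrite [LHS](congr1 _ (tadd_pi s t)) !tscale_pi [RHS]tadd_pi /sc map_cat.
Qed.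

Let tscaleDl x : {morph tscale^~ x : k l / k + l}.
Proof.
move=> k l; elim/tensor_piK: x => s.
by rewrite !tscale_pi [RHS]tadd_pi; exact/tensor_piP/sc_cat.
Qed.

HB.instance Definition _ :=
  GRing.Zmodule_isLmodule.Build K tensor tscaleA tscale1 tscaleDr tscaleDl.

Definition tens (u : U) (v : V) : tensor := \pi_tensor [:: (u, v)].

Lemma tens_bilinear : bilinear_map tens.
Proof.
split=> [u|v]; apply: linP => [x y|k x].
- by rewrite [RHS]tadd_pi; exact/tensor_piP/teqv_addr.
- by rewrite [RHS]tscale_pi; exact/tensor_piP/teqv_sym/teqv_scale.
- by rewrite [RHS]tadd_pi; exact/tensor_piP/teqv_addl.
- by rewrite [RHS]tscale_pi.
Qed.

Lemma tens_ind (P : tensor -> Prop) :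
  (forall u v, P (tens u v)) -> (forall x y, P x -> P y -> P (x + y)) ->
  forall x, P x.
Proof.
move=> Pt PD; elim/tensor_piK; elim=> [|[u v] s IHs].
  have -> : \pi_tensor [::] = tens 0 0 by apply/tensor_piP/teqv_sym/teqv_zero.
  exact: Pt.
by rewrite -cat1s -tadd_pi; apply: PD => //; exact: Pt.
Qed.

(* The linear map induced by f, meaningful only when f is bilinear. *)
Definition tlift (W : lmodType K) (f : U -> V -> W) (x : tensor) : W :=
  \sum_(p <- repr x) f p.1 p.2.

Section Lift.
Variables (W : lmodType K) (f : U -> V -> W).
Hypothesis bf : bilinear_map f.

Let sum_eqv s t :
  tensor_eqv s t -> \sum_(p <- s) f p.1 p.2 = \sum_(p <- t) f p.1 p.2.
Proof.
case: bf => fl fr.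
elim=> {s t} [s|s t _ ->|s t r _ -> _ ->|s s' t t' _ IH _ IH'|s t|v|u u' v|u v v'|k u v] //.
- by rewrite !big_cat /= IH IH'.
- by rewrite !big_cat /= addrC.
- by rewrite big_seq1 big_nil /= (lin0 (fr v)).
- by rewrite !big_cons big_nil /= !addr0 (linD (fr v)).
- by rewrite !big_cons big_nil /= !addr0 (linD (fl u)).
- by rewrite !big_seq1 /= (linZ (fl u)) (linZ (fr v)).
Qed.

Let tlift_pi s : tlift f (\pi_tensor s) = \sum_(p <- s) f p.1 p.2.
Proof. exact/sum_eqv/tensor_reprP. Qed.

Lemma tlift_linear : linear (tlift f).
Proof.
case: bf => fl fr; apply: linP => [|k].
  elim/tensor_piK=> s; elim/tensor_piK=> t.
  by rewrite [X in tlift f X]tadd_pi !tlift_pi big_cat.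
elim/tensor_piK=> s; rewrite [X in tlift f X]tscale_pi !tlift_pi big_map.
by rewrite scaler_sumr; apply: eq_bigr => p _ /=; rewrite (linZ (fr _)).
Qed.

Lemma tliftE u v : tlift f (tens u v) = f u v.
Proof. by rewrite tlift_pi big_seq1. Qed.

End Lift.

Lemma tens_eq (W : lmodType K) (f g : tensor -> W) :
  linear f -> linear g -> (forall u v, f (tens u v) = g (tens u v)) -> f =1 g.
Proof.
move=> lf lg fg; elim/tens_ind=> // x y fx fy.
by rewrite (linD lf) (linD lg) fx fy.
Qed.

End Tensor.

Definition tmap (K : fieldType) (U V U' V' : lmodType K)
    (f : U -> U') (g : V -> V') : tensor U V -> tensor U' V' :=
  tlift (fun u v => tens (f u) (g v)).

Section TensorMaps.
Variable K : fieldType.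
Implicit Types U V W : lmodType K.

Lemma tensDl U V (v : V) : {morph (fun u : U => tens u v) : x y / x + y}.
Proof. exact: linD ((tens_bilinear U V).2 v). Qed.
Lemma tensDr U V (u : U) : {morph (tens u : V -> _) : x y / x + y}.
Proof. exact: linD ((tens_bilinear U V).1 u). Qed.
Lemma tensZl U V (v : V) k : {morph (fun u : U => tens u v) : x / k *: x}.
Proof. exact: linZ ((tens_bilinear U V).2 v) k. Qed.
Lemma tensZr U V (u : U) k : {morph (tens u : V -> _) : x / k *: x}.
Proof. exact: linZ ((tens_bilinear U V).1 u) k. Qed.
Lemma tensNl U V (v : V) : {morph (fun u : U => tens u v) : x / - x}.
Proof. exact: linN ((tens_bilinear U V).2 v). Qed.
Lemma tensNr U V (u : U) : {morph (tens u : V -> _) : x / - x}.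
Proof. exact: linN ((tens_bilinear U V).1 u). Qed.
Lemma tensBl U V (v : V) : {morph (fun u : U => tens u v) : x y / x - y}.
Proof. exact: linB ((tens_bilinear U V).2 v). Qed.
Lemma tensBr U V (u : U) : {morph (tens u : V -> _) : x y / x - y}.
Proof. exact: linB ((tens_bilinear U V).1 u). Qed.
Lemma tens0l U V (v : V) : tens (0 : U) v = 0.
Proof. exact: lin0 ((tens_bilinear U V).2 v). Qed.
Lemma tens0r U V (u : U) : tens u (0 : V) = 0.
Proof. exact: lin0 ((tens_bilinear U V).1 u). Qed.

Lemma tmap_bilinear U V U' V' (f : U -> U') (g : V -> V') :
  linear f -> linear g -> bilinear_map (fun u v => tens (f u) (g v)).
Proof.
move=> lf lg; split=> [u|v] k x y.
  by rewrite lg tensDr tensZr.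
by rewrite lf tensDl tensZl.
Qed.

Lemma tmap_linear U V U' V' (f : U -> U') (g : V -> V') :
  linear f -> linear g -> linear (tmap f g).
Proof. by move=> lf lg; exact/tlift_linear/tmap_bilinear. Qed.

Lemma tmapE U V U' V' (f : U -> U') (g : V -> V') u v :
  linear f -> linear g -> tmap f g (tens u v) = tens (f u) (g v).
Proof. by move=> lf lg; exact/tliftE/tmap_bilinear. Qed.

(* Lifting a family of bilinear maps that depends linearly on a parameter *)
Lemma tlift_param U V W (X : lmodType K) (f : X -> U -> V -> W) :
  (forall x, bilinear_map (f x)) -> (forall u v, linear (fun x => f x u v)) ->
  forall t, linear (fun x => tlift (f x) t).
Proof.
move=> bf lf t k x y; elim/tens_ind: t => [u v|s t]; first by rewrite !tliftE // lf.
by rewrite !(linD (tlift_linear (bf _))) => -> ->; rewrite scalerDr addrACA.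
Qed.

(* The bilinear operation (u (x) v, u' (x) v') |-> f u v u' v' *)
Definition tlift2 U V U' V' W (f : U -> V -> U' -> V' -> W)
    (s : tensor U V) (t : tensor U' V') : W :=
  tlift (fun u v => tlift (f u v) t) s.

Definition quadrilinear U V U' V' W (f : U -> V -> U' -> V' -> W) : Prop :=
  (forall u v, bilinear_map (f u v)) /\
  (forall u' v', bilinear_map (fun u v => f u v u' v')).

Lemma tlift2_sub U V U' V' W (f : U -> V -> U' -> V' -> W) :
  quadrilinear f -> forall t, bilinear_map (fun u v => tlift (f u v) t).
Proof.
move=> [bf bf'] t; split=> [u|v]; apply: tlift_param => // u' v'.
  by have [h _] := bf' u' v'.
by have [_ h] := bf' u' v'.
Qed.

Lemma tlift2_bilinear U V U' V' W (f : U -> V -> U' -> V' -> W) :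
  quadrilinear f -> bilinear_map (tlift2 f).
Proof.
move=> qf; have bl := tlift2_sub qf; case: (qf) => bf bf'.
split=> [s|t]; last exact: tlift_linear.
apply: tlift_param => // u v; exact: tlift_linear.
Qed.

Lemma tlift2E U V U' V' W (f : U -> V -> U' -> V' -> W) u v u' v' :
  quadrilinear f -> tlift2 f (tens u v) (tens u' v') = f u v u' v'.
Proof.
by move=> qf; rewrite /tlift2 tliftE; [rewrite tliftE //; case: qf|exact: tlift2_sub].
Qed.

End TensorMaps.

(* -------------------------------------------------------------------- *)
Section LieAlgebras.
Variable K : fieldType.

Definition is_lie_bracket (V : lmodType K) (br : V -> V -> V) : Prop :=
  [/\ bilinear_map br,
      forall x, br x x = 0 &
      forall x y z, br x (br y z) + br y (br z x) + br z (br x y) = 0].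

Record lieAlg := LieAlg {
  lie_mod :> lmodType K;
  lie_br : lie_mod -> lie_mod -> lie_mod;
  lie_brP : is_lie_bracket lie_br }.

Definition is_lie_hom (L L' : lieAlg) (f : L -> L') : Prop :=
  linear f /\ forall x y, f (lie_br x y) = lie_br (f x) (f y).

Lemma lie_anti (L : lieAlg) (x y : L) : lie_br x y = - lie_br y x.
Proof.
have [[bl br] alt _] := lie_brP L.
have := alt (x + y).
rewrite (linD (bl _)) (linD (br x)) (linD (br y)) !alt add0r addr0.
by move/eqP; rewrite addrC addr_eq0 => /eqP.
Qed.

Lemma tensor_lie_bracket (U V : lmodType K)
    (br : tensor U V -> tensor U V -> tensor U V) :
  bilinear_map br ->
  (forall u v u' v', br (tens u v) (tens u' v') = - br (tens u' v') (tens u v)) ->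
  (forall u v, br (tens u v) (tens u v) = 0) ->
  (forall u1 v1 u2 v2 u3 v3,
     let x := tens u1 v1 in let y := tens u2 v2 in let z := tens u3 v3 in
     br x (br y z) + br y (br z x) + br z (br x y) = 0) ->
  is_lie_bracket br.
Proof.
move=> bb anti alt jac; case: (bb) => bl br'.
have Dl z : {morph br^~ z : x y / x + y} by exact: linD (br' z).
have Dr z : {morph br z : x y / x + y} by exact: linD (bl z).
have antis x y : br x y = - br y x.
  elim/tens_ind: x y => [u v|x x' IH IH'] y; last by rewrite Dl Dr IH IH' opprD.
  by elim/tens_ind: y => [u' v'|y y' IH IH']; [exact: anti|rewrite Dr Dl IH IH' opprD].
pose J x y z := br x (br y z) + br y (br z x) + br z (br x y).
have JC x y z : J x y z = J y z x.
  by rewrite /J [RHS]addrC addrA.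
have JD x x' y z : J (x + x') y z = J x y z + J x' y z.
  by rewrite /J Dl (Dr z) (Dl y) 2!Dr (addrACA (br x _)) (addrACA (br x _ + _)).
split=> //.
  elim/tens_ind=> // x y xx yy.
  by rewrite Dr !Dl xx yy add0r addr0 [br y x]antis addNr.
move=> x y z; rewrite -/(J x y z).
elim/tens_ind: x y z => [u1 v1|x x' IH IH'] y z; last by rewrite JD IH IH' addr0.
rewrite JC.
elim/tens_ind: y z => [u2 v2|x x' IH IH'] z; last by rewrite JD IH IH' addr0.
rewrite JC.
elim/tens_ind: z => [u3 v3|x x' IH IH']; last by rewrite JD IH IH' addr0.
by rewrite JC; exact: jac.
Qed.

End LieAlgebras.

(* -------------------------------------------------------------------- *)
(* gl_K(V): all K-linear endomorphisms, V of any dimension *)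
Section Endomorphisms.
Variables (K : fieldType) (V : lmodType K).

Definition endo_pred : {pred V -> V} := fun f => `[< linear f >].

Record endo := Endo { endo_fun :> V -> V; endo_mem : endo_fun \in endo_pred }.

Lemma endoP (f : endo) : linear f.
Proof. by apply/asboolP; exact: endo_mem f. Qed.

Lemma endo_predP (f : V -> V) : linear f -> f \in endo_pred.
Proof. by move=> lf; apply/asboolP. Qed.

Definition mk_endo (f : V -> V) (lf : linear f) : endo := Endo (endo_predP lf).

Lemma endo_closed : submod_closed endo_pred.
Proof.
split=> [|k f g /asboolP lf /asboolP lg]; apply: endo_predP => c x y.
  by change (0 = c *: (0 : V) + 0); rewrite scaler0 addr0.
change (k *: f (c *: x + y) + g (c *: x + y) =
        c *: (k *: f x + g x) + (k *: f y + g y)).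
by rewrite lf lg !scalerDr !scalerA addrACA (mulrC k).
Qed.
HB.instance Definition _ :=
  GRing.isSubmodClosed.Build K (V -> V) endo_pred endo_closed.

HB.instance Definition _ := [isSub for endo_fun].
HB.instance Definition _ := [Choice of endo by <:].
HB.instance Definition _ :=
  GRing.SubChoice_isSubLmodule.Build K (V -> V) endo_pred endo
    (GRing.subsemimodClosedP _).

Lemma endo_ext (f g : endo) : f =1 g -> f = g.
Proof. by move=> fg; apply/val_inj/funext. Qed.

Lemma endo_lincomb k (f g : endo) v : (k *: f + g) v = k *: f v + g v.
Proof. by change (val (k *: f + g) v = k *: f v + g v); rewrite linearP. Qed.

Lemma endoD (f g : endo) v : (f + g) v = f v + g v.
Proof. by change (val (f + g) v = f v + g v); rewrite raddfD. Qed.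

Lemma endo0 v : (0 : endo) v = 0.
Proof. by change (val (0 : endo) v = 0); rewrite raddf0. Qed.

Lemma endo_comm_linear (f g : endo) : linear (fun v => f (g v) - g (f v)).
Proof.
by move=> k x y; rewrite !(endoP f, endoP g) scalerBr opprD addrACA.
Qed.

Definition endo_br (f g : endo) : endo := mk_endo (endo_comm_linear f g).

Lemma endo_brE f g v : endo_br f g v = f (g v) - g (f v).
Proof. by []. Qed.

End Endomorphisms.

Arguments mk_endo {K V} f lf.

Lemma jacobi_cancel (V : zmodType) (a b c d e f : V) :
  (a - b - (c - d)) + (c - e - (f - b)) + (f - d - (a - e)) = 0.
Proof.
rewrite !opprB.
rewrite [LHS](AC ((2*2)*(2*2)*(2*2)) ((1*12)*(2*7)*(3*10)*(4*5)*(6*11)*(8*9))).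
by rewrite /= !subrr !addNr !addr0.
Qed.

Section CommutatorLie.
Variable K : fieldType.

Lemma endo_br_lie (V : lmodType K) : is_lie_bracket (@endo_br K V).
Proof.
split=> [|f|f g h]; last 2 first.
- by apply: endo_ext => v; rewrite endo_brE subrr endo0.
- apply: endo_ext => v; rewrite !(endoD, endo_brE, endo0) !(linB (endoP _)).
  exact: jacobi_cancel.
split=> [f|g] k x y; apply: endo_ext => v; rewrite !(endo_lincomb, endo_brE).
  by rewrite (endoP f) scalerBr opprD addrACA.
by rewrite (endoP g) scalerBr opprD addrACA.
Qed.
Definition glLie (V : lmodType K) : lieAlg K := LieAlg (@endo_br_lie V).

Definition mx_br n (x y : 'M[K]_n) : 'M[K]_n := x *m y - y *m x.

Lemma mx_br_lie n : is_lie_bracket (@mx_br n).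
Proof.
split=> [|x|x y z]; rewrite /mx_br; last 2 first.
- by rewrite subrr.
- rewrite !mulmxBr !mulmxBl !mulmxA; exact: jacobi_cancel.
split=> [x|y] k z t.
  by rewrite mulmxDr mulmxDl -scalemxAr -scalemxAl scalerBr opprD addrACA.
by rewrite mulmxDr mulmxDl -scalemxAr -scalemxAl scalerBr opprD addrACA.
Qed.
Definition glmx n : lieAlg K := LieAlg (@mx_br_lie n).

End CommutatorLie.

(* -------------------------------------------------------------------- *)
Section Derivations.
Variables (K : fieldType) (A : comAlgType K).

Definition der_pred : {pred endo A} :=
  fun d => `[< forall a b, d (a * b) = d a * b + a * d b >].

Record der := Der { der_endo :> endo A; der_mem : der_endo \in der_pred }.

Lemma derM (d : der) a b : d (a * b) = d a * b + a * d b.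
Proof. by have /asboolP := der_mem d. Qed.

Lemma der_closed : submod_closed der_pred.
Proof.
split=> [|k d e /asboolP hd /asboolP he]; apply/asboolP => a b.
  by rewrite !endo0 mul0r mulr0 addr0.
rewrite !endo_lincomb hd he scalerDr mulrDl mulrDr -!scalerAl -!scalerAr.
by rewrite addrACA.
Qed.
HB.instance Definition _ :=
  GRing.isSubmodClosed.Build K (endo A) der_pred der_closed.

HB.instance Definition _ := [isSub for der_endo].
HB.instance Definition _ := [Choice of der by <:].
HB.instance Definition _ :=
  GRing.SubChoice_isSubLmodule.Build K (endo A) der_pred der
    (GRing.subsemimodClosedP _).

Lemma der_ext (d e : der) : d =1 e -> d = e.
Proof. by move=> de; apply/val_inj/endo_ext. Qed.

Lemma der_lincomb k (d e : der) a : (k *: d + e) a = k *: d a + e a.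
Proof. by rewrite -endo_lincomb. Qed.
Lemma derD (d e : der) a : (d + e) a = d a + e a.
Proof. by rewrite -endoD. Qed.
Lemma der0 a : (0 : der) a = 0.
Proof. by rewrite -[RHS](endo0 a). Qed.
Lemma derZ k (d : der) a : (k *: d) a = k *: d a.
Proof. by rewrite -[k *: d]addr0 der_lincomb der0 addr0. Qed.
Lemma derB (d e : der) a : (d - e) a = d a - e a.
Proof. by rewrite -[- e]scaleN1r derD derZ scaleN1r. Qed.
Lemma der_sum n (F : 'I_n -> der) a : (\sum_i F i) a = \sum_i F i a.
Proof.
apply: (big_morph (fun d : der => d a)) => [d e|]; first exact: derD.
exact: der0.
Qed.

Lemma derDr (d : der) : {morph d : a b / a + b}.
Proof. exact: linD (endoP d). Qed.
Lemma derBr (d : der) : {morph d : a b / a - b}.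
Proof. exact: linB (endoP d). Qed.
Lemma derZr (d : der) k : {morph d : a / k *: a}.
Proof. exact: linZ (endoP d) k. Qed.

Lemma der_br_mem (d e : der) : endo_br d e \in der_pred.
Proof.
apply/asboolP => a b; rewrite !endo_brE !derM !derDr !derM; ring.
Qed.
Definition der_br (d e : der) : der := Der (der_br_mem d e).

Lemma der_brE d e a : der_br d e a = d (e a) - e (d a).
Proof. by []. Qed.

Lemma der_br_lie : is_lie_bracket der_br.
Proof.
split=> [|d|d e f]; last 2 first.
- by apply: der_ext => a; rewrite der_brE subrr der0.
- apply: der_ext => a; rewrite !(derD, der_brE, der0, derBr).
  exact: jacobi_cancel.
split=> [d|e] k x y; apply: der_ext => a; rewrite !(der_lincomb, der_brE).
  by rewrite (endoP d) scalerBr opprD addrACA.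
by rewrite (endoP e) scalerBr opprD addrACA.
Qed.
Definition derLie : lieAlg K := LieAlg der_br_lie.

Lemma smul_der_linear (a : A) (d : der) : linear (fun b => a * d b).
Proof. by move=> k x y; rewrite (endoP d) mulrDr scalerAr. Qed.

Lemma smul_der_mem a d : mk_endo _ (smul_der_linear a d) \in der_pred.
Proof.
by apply/asboolP => b c /=; rewrite derM mulrDr !mulrA [b * a]mulrC.
Qed.
Definition smul_der a d : der := Der (smul_der_mem a d).

Lemma smul_derE a d b : smul_der a d b = a * d b.
Proof. by []. Qed.

End Derivations.

Arguments derM {K A} d a b.

(* -------------------------------------------------------------------- *)
(* The underlying K-vector space of a module over a K-algebra *)
Definition restr (K : fieldType) (A : comAlgType K) (M : lmodType A) : Type := M.

Section Restriction.
Variables (K : fieldType) (A : comAlgType K) (M : lmodType A).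
HB.instance Definition _ := GRing.Zmodule.copy (restr M) M.

Definition restr_scale (k : K) (m : restr M) : restr M := k%:A *: (m : M).

Fact restr_scaleA k l m : restr_scale k (restr_scale l m) = restr_scale (k * l) m.
Proof. by rewrite /restr_scale scalerA -scalerAl mul1r scalerA. Qed.
Fact restr_scale1 : left_id 1 restr_scale.
Proof. by move=> m; rewrite /restr_scale !scale1r. Qed.
Fact restr_scaleDr : right_distributive restr_scale +%R.
Proof. by move=> k m m'; rewrite /restr_scale scalerDr. Qed.
Fact restr_scaleDl m : {morph restr_scale^~ m : k l / k + l}.
Proof. by move=> k l; rewrite /restr_scale !scalerDl. Qed.

HB.instance Definition _ := GRing.Zmodule_isLmodule.Build K (restr M)
  restr_scaleA restr_scale1 restr_scaleDr restr_scaleDl.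
End Restriction.

(* -------------------------------------------------------------------- *)
Lemma semidirect_addrAC (V : zmodType) (a a' b b' c c' : V) :
  (a + a') - (b + b') + (c + c') = (a - b + c) + (a' - b' + c').
Proof. by rewrite opprD (addrACA a) (addrACA (a - b)). Qed.

Lemma semidirect_cancel (V : zmodType) (a1 a2 b1 b2 c d m p q r s t j1 j2 j3 : V) :
  (a1 - a2 + (- p + q) - (b1 - b2) + (r - s + j1)) +
  (b1 - c + (- r + t) - (d - a2) + (m - q + j2)) +
  (d - b2 + (- m + s) - (a1 - c) + (p - t + j3)) = j1 + j2 + j3.
Proof.
rewrite !opprB.
rewrite [LHS](AC ((2*2*2*3)*(2*2*2*3)*(2*2*2*3))
  ((1*24)*(2*14)*(3*25)*(4*17)*(5*20)*(6*10)*(7*12)*(8*22)*(11*23)*(13*26)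
   *(15*19)*(16*21)*(9*18*27))).
by rewrite /= !(subrr, addNr) !add0r.
Qed.

Section SemidirectProducts.
Variable K : fieldType.
Implicit Types L h : lieAlg K.

(* an action of L on h by derivations, i.e. a homomorphism L -> Der(h) *)
Record lieAction L h := LieAction {
  la_act :> L -> endo h;
  la_hom : is_lie_hom (L' := glLie h) la_act;
  la_der : forall x u v,
    la_act x (lie_br u v) = lie_br (la_act x u) v + lie_br u (la_act x v) }.

Record crossedHom L h (act : lieAction L h) := CrossedHom {
  ch_fun :> L -> h;
  ch_linear : linear ch_fun;
  ch_crossed : forall x y,
    ch_fun (lie_br x y) =
      act x (ch_fun y) - act y (ch_fun x) + lie_br (ch_fun x) (ch_fun y) }.

Definition semidirect_br L h (act : lieAction L h) (p q : (L * h)%type) :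
    (L * h)%type :=
  (lie_br p.1 q.1, act p.1 q.2 - act q.1 p.2 + lie_br p.2 q.2).

Lemma semidirect_lie L h (act : lieAction L h) :
  is_lie_bracket (semidirect_br act).
Proof.
have [[Ll Lr] La LJ] := lie_brP L; have [[hl hr] ha hJ] := lie_brP h.
have [lact actbr] := la_hom act; have ader := la_der act.
have lactE k x y u : act (k *: x + y) u = k *: act x u + act y u.
  by rewrite lact endo_lincomb.
have actE x k u v : act x (k *: u + v) = k *: act x u + act x v.
  exact: endoP.
have actbrE x y u : act (lie_br x y) u = act x (act y u) - act y (act x u).
  by rewrite actbr.
split.
- split=> p k q r; rewrite /semidirect_br; apply/eqP; rewrite xpair_eqE /=.
    rewrite Ll eqxx /= hl lactE actE; apply/eqP.
    by rewrite semidirect_addrAC !(scalerDr, scalerN).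
  rewrite Lr eqxx /= hr lactE actE; apply/eqP.
  by rewrite semidirect_addrAC !(scalerDr, scalerN).
- by move=> p; rewrite /semidirect_br La ha subrr addr0.
move=> [x u] [y v] [z w]; rewrite /semidirect_br /=.
apply/eqP; rewrite xpair_eqE /= LJ eqxx /=; apply/eqP.
have actD x' a b : act x' (a + b) = act x' a + act x' b by exact: (linD (endoP (act x'))).
have actN x' a : act x' (- a) = - act x' a by exact: (linN (endoP (act x'))).
have hrD (a b c : h) : lie_br a (b + c) = lie_br a b + lie_br a c by exact: (linD (hl a)).
have hrN (a b : h) : lie_br a (- b) = - lie_br a b by exact: (linN (hl a)).
rewrite !(actD, actN, actbrE, ader, hrD, hrN).
rewrite (lie_anti (act x v) w) (lie_anti (act y w) u) (lie_anti (act z u) v).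
by rewrite semidirect_cancel hJ.
Qed.

Definition semidirect L h (act : lieAction L h) : lieAlg K :=
  LieAlg (semidirect_lie act).

Definition iota_ch L h (act : lieAction L h) (H : crossedHom act) (x : L) :
  semidirect act := (x, H x).

End SemidirectProducts.

(* -------------------------------------------------------------------- *)
Section CurrentAlgebra.
Variables (K : fieldType) (g : lieAlg K) (A : comAlgType K).

Definition cur_br : tensor g A -> tensor g A -> tensor g A :=
  tlift2 (fun x a y b => tens (lie_br x y) (a * b)).

Fact cur_quad : quadrilinear (fun (x : g) (a : A) (y : g) (b : A) =>
  tens (lie_br x y) (a * b)).
Proof.
have [[gl gr] _ _] := lie_brP g.
split=> x a; split=> y k u v.
- by rewrite mulrDr -scalerAr tensDr tensZr.
- by rewrite gl tensDl tensZl.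
- by rewrite mulrDl -scalerAl tensDr tensZr.
- by rewrite gr tensDl tensZl.
Qed.

Lemma cur_brE x a y b :
  cur_br (tens x a) (tens y b) = tens (lie_br x y) (a * b).
Proof. exact: tlift2E cur_quad. Qed.

Lemma cur_br_lie : is_lie_bracket cur_br.
Proof.
have [_ ga gJ] := lie_brP g.
apply: tensor_lie_bracket.
- exact: tlift2_bilinear cur_quad.
- by move=> x a y b; rewrite !cur_brE lie_anti tensNl mulrC.
- by move=> x a; rewrite cur_brE ga tens0l.
move=> x1 a1 x2 a2 x3 a3 /=; rewrite !cur_brE.
have -> : a2 * (a3 * a1) = a1 * (a2 * a3) by ring.
have -> : a3 * (a1 * a2) = a1 * (a2 * a3) by ring.
by rewrite -!tensDl gJ tens0l.
Qed.
Definition curLie : lieAlg K := LieAlg cur_br_lie.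

End CurrentAlgebra.

(* -------------------------------------------------------------------- *)
Section LieRinehart.
Variables (K : fieldType) (A : comAlgType K).

Record lieRinehart := LieRinehart {
  lr_mod :> lmodType A;
  lr_br : restr lr_mod -> restr lr_mod -> restr lr_mod;
  lr_brP : is_lie_bracket lr_br;
  anchor : lr_mod -> der A;
  anchor_hom : is_lie_hom (L := LieAlg lr_brP) (L' := derLie A) anchor;
  anchor_scale : forall a x b, anchor (a *: x) b = a * anchor x b;
  lr_leibniz : forall (x y : lr_mod) a,
    lr_br x (a *: y) = a *: (lr_br x y : lr_mod) + anchor x a *: y }.

Definition lr_lie (L : lieRinehart) : lieAlg K := LieAlg (lr_brP L).

(* the action x . (g (x) a) = g (x) anchor x a of L on g (x) A *)
Section CurrentAction.
Variables (L : lieRinehart) (g : lieAlg K).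

Definition cur_act_fun (x : L) : curLie g A -> curLie g A :=
  tmap id (anchor x).

Fact id_linear (V : lmodType K) : linear (@id V). Proof. by []. Qed.

Fact cur_act_linear x : linear (cur_act_fun x).
Proof. by apply: tmap_linear; [exact: id_linear|exact: endoP]. Qed.

Fact cur_actE x u a : cur_act_fun x (tens u a) = tens u (anchor x a).
Proof. by rewrite [LHS]tmapE //; exact: endoP. Qed.

Definition cur_act (x : lr_lie L) : endo (curLie g A) :=
  mk_endo (cur_act_fun x) (cur_act_linear x).

Fact cur_act_hom : is_lie_hom (L' := glLie (curLie g A)) cur_act.
Proof.
have [al abr] := anchor_hom L.
split=> [k x y|x y]; apply: endo_ext; elim/tens_ind.
- move=> u a; rewrite endo_lincomb [LHS]cur_actE [in RHS]/= !cur_actE al.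
  by rewrite der_lincomb tensDr tensZr.
- by move=> s t IHs IHt; rewrite !(linD (endoP _)) IHs IHt.
- move=> u a; rewrite [LHS]cur_actE [RHS]endo_brE /= !cur_actE abr.
  by rewrite der_brE tensBr.
- by move=> s t IHs IHt; rewrite !(linD (endoP _)) IHs IHt.
Qed.

Fact cur_act_der (x : lr_lie L) (s t : curLie g A) :
  cur_act x (lie_br s t) = lie_br (cur_act x s) t + lie_br s (cur_act x t).
Proof.
have [[bl br] _ _] := lie_brP (curLie g A).
have Dl z := linD (br z); have Dr z := linD (bl z).
have cD := linD (endoP (cur_act x)).
elim/tens_ind: s t => [u a|s s' IH IH'] t; last first.
  by rewrite Dl cD IH IH' cD !Dl addrACA.
elim/tens_ind: t => [v b|t t' IH IH']; last first.
  by rewrite Dr cD IH IH' cD !Dr addrACA.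
by rewrite /= cur_brE !cur_actE !cur_brE derM tensDr.
Qed.

Definition cur_action : lieAction (lr_lie L) (curLie g A) :=
  LieAction cur_act_hom cur_act_der.
End CurrentAction.

End LieRinehart.

(* -------------------------------------------------------------------- *)
Record category := Category {
  cat_obj :> Type;
  cat_hom : cat_obj -> cat_obj -> Type;
  cat_id : forall X, cat_hom X X;
  cat_comp : forall X Y Z, cat_hom Y Z -> cat_hom X Y -> cat_hom X Z;
  cat_idl : forall X Y (f : cat_hom X Y), cat_comp (cat_id Y) f = f;
  cat_idr : forall X Y (f : cat_hom X Y), cat_comp f (cat_id X) = f;
  cat_assoc : forall X Y Z T (h : cat_hom Z T) (g : cat_hom Y Z) (f : cat_hom X Y),
    cat_comp h (cat_comp g f) = cat_comp (cat_comp h g) f }.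

Definition is_functor (C D : category) (Fo : C -> D)
    (Fm : forall X Y, cat_hom X Y -> cat_hom (Fo X) (Fo Y)) : Prop :=
  (forall X, Fm X X (cat_id X) = cat_id (Fo X)) /\
  (forall X Y Z (g : cat_hom Y Z) (f : cat_hom X Y),
     Fm X Z (cat_comp g f) = cat_comp (Fm Y Z g) (Fm X Y f)).

(* -------------------------------------------------------------------- *)
Section Representations.
Variables (K : fieldType) (L : lieAlg K).

Record lieRep := LieRep {
  rep_mod :> lmodType K;
  rep_act : L -> endo rep_mod;
  rep_actP : is_lie_hom (L' := glLie rep_mod) rep_act }.

Record repHom (V W : lieRep) := RepHom {
  rh_fun :> V -> W;
  rh_linear : linear rh_fun;
  rh_act : forall x v, rh_fun (rep_act V x v) = rep_act W x (rh_fun v) }.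

Lemma repHom_ext V W (f g : repHom V W) : f =1 g -> f = g.
Proof.
case: f g => [f lf af] [g lg ag] /= /funext fg; case: _ / fg in lg ag *.
by congr RepHom; exact: Prop_irrelevance.
Qed.

Definition rep_id V : repHom V V := @RepHom V V id (@id_linear _ V) (fun _ _ => erefl).

Fact rep_comp_linear V W X (g : repHom W X) (f : repHom V W) : linear (g \o f).
Proof. by move=> k x y /=; rewrite !rh_linear. Qed.
Fact rep_comp_act V W X (g : repHom W X) (f : repHom V W) x v :
  (g \o f) (rep_act V x v) = rep_act X x ((g \o f) v).
Proof. by rewrite /= !rh_act. Qed.
Definition rep_comp V W X (g : repHom W X) (f : repHom V W) : repHom V X :=
  RepHom (rep_comp_linear g f) (rep_comp_act g f).

Definition repCat : category.
Proof.
by refine (@Category lieRep repHom rep_id rep_comp _ _ _) => *; exact: repHom_ext.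
Defined.

End Representations.

Section WeakRepresentations.
Variables (K : fieldType) (A : comAlgType K) (L : lieRinehart A).

Definition is_weak_rep (M : lmodType A) (rho : L -> endo (restr M)) : Prop :=
  is_lie_hom (L := lr_lie L) (L' := glLie (restr M)) rho /\
  forall (x : L) (a : A) (m : M),
    rho x (a *: m) = a *: (rho x m : M) + anchor x a *: m.

Record weakRep := WeakRep {
  wr_mod :> lmodType A;
  wr_act : L -> endo (restr wr_mod);
  wr_actP : is_weak_rep wr_act }.

Definition is_weak_hom (M N : lmodType A) (rho : L -> endo (restr M))
    (sigma : L -> endo (restr N)) (f : M -> N) : Prop :=
  linear f /\ forall x m, f (rho x m) = sigma x (f m).

Record weakHom (M N : weakRep) := WeakHom {
  wh_fun :> M -> N;
  wh_P : is_weak_hom (wr_act M) (wr_act N) wh_fun }.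

Lemma weakHom_ext M N (f g : weakHom M N) : f =1 g -> f = g.
Proof.
case: f g => [f hf] [g hg] /= /funext fg; case: _ / fg in hg *.
by congr WeakHom; exact: Prop_irrelevance.
Qed.

Fact weak_idP (M : weakRep) : is_weak_hom (wr_act M) (wr_act M) id.
Proof. by []. Qed.
Definition weak_id M : weakHom M M := WeakHom (weak_idP M).

Fact weak_compP M N P (g : weakHom N P) (f : weakHom M N) :
  is_weak_hom (wr_act M) (wr_act P) (g \o f).
Proof.
have [lg ag] := wh_P g; have [lf af] := wh_P f.
by split=> [a x y|x m] /=; rewrite ?lf ?lg ?af ?ag.
Qed.
Definition weak_comp M N P (g : weakHom N P) (f : weakHom M N) : weakHom M P :=
  WeakHom (weak_compP g f).

Definition wrepCat : category.
Proof.
by refine (@Category weakRep weakHom weak_id weak_comp _ _ _) => *;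
  exact: weakHom_ext.
Defined.

End WeakRepresentations.

(* -------------------------------------------------------------------- *)
(* V (x) A, with A acting on the right factor; a separate name from tensor V A,
   which carries the K-module structure *)
Definition extmod (K : fieldType) (A : comAlgType K) (V : lmodType K) : Type :=
  tensor V A.

Section ScalarExtension.
Variables (K : fieldType) (A : comAlgType K).

Section Module.
Variable V : lmodType K.
HB.instance Definition _ := GRing.Zmodule.copy (extmod A V) (tensor V A).

Definition ext_scale (a : A) : extmod A V -> extmod A V :=
  tmap (@id V) (fun b : A => a * b).

Fact mull_linear (a : A) : linear (fun b : A => a * b).
Proof. by move=> k x y; rewrite mulrDr scalerAr. Qed.

Fact ext_scale_linear a : linear (ext_scale a : tensor V A -> tensor V A).
Proof. by apply: tmap_linear; [exact: id_linear|exact: mull_linear]. Qed.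

Lemma ext_scaleE a v b : ext_scale a (tens v b) = tens v (a * b).
Proof. by rewrite [LHS]tmapE //; exact: mull_linear. Qed.

Fact ext_scaleDr : right_distributive ext_scale +%R.
Proof. by move=> a s t; exact: linD (ext_scale_linear a) s t. Qed.
Fact ext_scaleA a b t : ext_scale a (ext_scale b t) = ext_scale (a * b) t.
Proof.
elim/tens_ind: t => [v c|s t IHs IHt]; first by rewrite !ext_scaleE mulrA.
by rewrite !ext_scaleDr IHs IHt.
Qed.
Fact ext_scale1 : left_id 1 ext_scale.
Proof.
by elim/tens_ind=> [v c|s t IHs IHt]; rewrite ?ext_scaleE ?mul1r ?ext_scaleDr ?IHs ?IHt.
Qed.
Fact ext_scaleDl t : {morph ext_scale^~ t : a b / a + b}.
Proof.
move=> a b; elim/tens_ind: t => [v c|s t IHs IHt].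
  by rewrite !ext_scaleE mulrDl tensDr.
by rewrite !ext_scaleDr IHs IHt [LHS]addrACA.
Qed.
HB.instance Definition _ := GRing.Zmodule_isLmodule.Build A (extmod A V)
  ext_scaleA ext_scale1 ext_scaleDr ext_scaleDl.

Lemma restr_ext_scale (k : K) (t : restr (extmod A V)) :
  k *: t = (k *: (t : tensor V A) : tensor V A).
Proof.
change (ext_scale k%:A t = (k *: (t : tensor V A) : tensor V A)).
elim/tens_ind: t => [v b|s t IHs IHt].
  by rewrite ext_scaleE -scalerAl mul1r tensZr.
by rewrite ext_scaleDr IHs IHt scalerDr.
Qed.

Lemma restr_ext_linear (f : tensor V A -> tensor V A) :
  linear f -> linear (f : restr (extmod A V) -> restr (extmod A V)).
Proof. by move=> lf k x y; rewrite !restr_ext_scale; exact: lf. Qed.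

End Module.

Variables (L : lieRinehart A) (g : lieAlg K).

(* x (x) a : v (x) b |-> theta(x) v (x) a b, extended linearly to g (x) A *)
Definition cur_on_ext (V : lieRep g) (w : curLie g A) :
    tensor V A -> tensor V A :=
  tlift2 (fun x a v b => tens (rep_act V x v) (a * b)) w.
#[local] Arguments cur_on_ext : clear implicits.

Fact cur_on_ext_quad (V : lieRep g) :
  quadrilinear (fun (x : g) (a : A) (v : V) (b : A) =>
    tens (rep_act V x v) (a * b)).
Proof.
have [rl _] := rep_actP V.
split=> x a; split=> y k u v.
- by rewrite mulrDr -scalerAr tensDr tensZr.
- by rewrite (endoP (rep_act V x)) tensDl tensZl.
- by rewrite mulrDl -scalerAl tensDr tensZr.
- by rewrite rl endo_lincomb tensDl tensZl.
Qed.

Fact cur_on_extE (V : lieRep g) x a v b :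
  cur_on_ext V (tens x a) (tens v b) = tens (rep_act V x v) (a * b).
Proof. exact: tlift2E (cur_on_ext_quad V). Qed.

Definition boxplus_fun (V : lieRep g) (p : semidirect (cur_action L g)) :
    extmod A V -> extmod A V :=
  fun t => tmap (@id V) (anchor p.1) t + cur_on_ext V p.2 t.
#[local] Arguments boxplus_fun : clear implicits.

Fact boxplus_linear (V : lieRep g) p :
  linear (boxplus_fun V p : restr (extmod A V) -> restr (extmod A V)).
Proof.
apply: restr_ext_linear => k x y; rewrite /boxplus_fun.
rewrite (tmap_linear (@id_linear _ V) (endoP (anchor p.1))).
have lc : linear (cur_on_ext V p.2) := (tlift2_bilinear (cur_on_ext_quad V)).1 p.2.
rewrite lc.
by rewrite scalerDr addrACA.
Qed.

Definition boxplus (V : lieRep g) (p : semidirect (cur_action L g)) :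
    endo (restr (extmod A V)) :=
  @mk_endo K (restr (extmod A V)) (boxplus_fun V p) (boxplus_linear p).

Lemma boxplusE (V : lieRep g) (x : L) (y : g) (a : A) (v : V) (b : A) :
  boxplus V (x, tens y a) (tens v b) =
  tens v (anchor x b) + tens (rep_act V y v) (a * b).
Proof.
change (tmap (@id V) (anchor x) (tens v b) + cur_on_ext V (tens y a) (tens v b)
  = tens v (anchor x b) + tens (rep_act V y v) (a * b) :> tensor V A).
by rewrite cur_on_extE tmapE //; exact: endoP.
Qed.

(* the action (alpha [+] theta) o iota_H of L on V (x) A *)
Definition FHA_act (H : crossedHom (cur_action L g)) (V : lieRep g) (x : L) :
    endo (restr (extmod A V)) :=
  boxplus V (iota_ch H x).

Definition FHA_mor (V W : lieRep g) (psi : repHom V W) :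
    extmod A V -> extmod A W :=
  tmap psi (@id A).

End ScalarExtension.

Arguments cur_on_ext {K A g} V w t.
Arguments boxplus_fun {K A L g} V p t.
Arguments boxplus {K A L g} V p.

(* -------------------------------------------------------------------- *)
Definition is_basis (K : fieldType) (V : lmodType K) (n : nat) (e : 'I_n -> V) :
    Prop :=
  forall v, exists! c : 'rV[K]_n, v = \sum_i c 0 i *: e i.

Section Basis.
Variables (K : fieldType) (V : lmodType K) (n : nat) (e : 'I_n -> V).
Hypothesis he : is_basis e.

Definition bcoord (v : V) : 'rV[K]_n := sval (cid (he v)).

Lemma bcoordP v : v = \sum_i bcoord v 0 i *: e i.
Proof. by rewrite /bcoord; case: cid => c [] . Qed.

Lemma bcoord_uniq v (c : 'rV[K]_n) : v = \sum_i c 0 i *: e i -> bcoord v = c.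
Proof.
by move=> vE; rewrite /bcoord; case: cid => c' [_ h] /=; exact: h.
Qed.

Lemma bcoord_linear : linear bcoord.
Proof.
move=> k x y; apply: bcoord_uniq.
rewrite {1}[x]bcoordP {1}[y]bcoordP scaler_sumr -big_split /=.
by apply: eq_bigr => i _; rewrite !mxE scalerDl scalerA.
Qed.

Lemma bcoord_basis i : bcoord (e i) = delta_mx 0 i.
Proof.
apply: bcoord_uniq; rewrite (bigD1 i) //= mxE !eqxx scale1r big1 ?addr0 // => j ji.
by rewrite mxE eqxx (negbTE ji) scale0r.
Qed.

End Basis.

(* -------------------------------------------------------------------- *)
Section DerivationSpace.
Variables (K : fieldType) (A : comAlgType K) (Delta : submodClosed (der A)).

Record dspace := DSpace { ds_der :> der A; ds_mem : ds_der \in Delta }.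

HB.instance Definition _ := [isSub for ds_der].
HB.instance Definition _ := [Choice of dspace by <:].
HB.instance Definition _ :=
  GRing.SubChoice_isSubLmodule.Build K (der A) (mem Delta) dspace
    (GRing.subsemimodClosedP Delta).

Lemma dspace_lincomb k (d e : dspace) a : (k *: d + e) a = k *: d a + e a.
Proof. by rewrite -der_lincomb. Qed.
Lemma dspaceD (d e : dspace) a : (d + e) a = d a + e a.
Proof. by rewrite -derD. Qed.
Lemma dspace0 a : (0 : dspace) a = 0.
Proof. by rewrite -[RHS](der0 a). Qed.
Lemma dspaceZ k (d : dspace) a : (k *: d) a = k *: d a.
Proof. by rewrite -derZ. Qed.
Lemma dspace_sum n (F : 'I_n -> dspace) a : (\sum_i F i) a = \sum_i F i a.
Proof.
apply: (big_morph (fun d : dspace => d a)) => [d e|]; first exact: dspaceD.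
exact: dspace0.
Qed.

(* A (x) Delta, with A acting on the left factor *)
Definition witt_mod : Type := tensor A dspace.
HB.instance Definition _ := GRing.Zmodule.copy witt_mod (tensor A dspace).

Definition witt_scale (a : A) : witt_mod -> witt_mod :=
  tmap (fun b : A => a * b) (@id dspace).

Fact witt_scale_linear a :
  linear (witt_scale a : tensor A dspace -> tensor A dspace).
Proof. by apply: tmap_linear; [exact: mull_linear|exact: id_linear]. Qed.

Lemma witt_scaleE a b d : witt_scale a (tens b d) = tens (a * b) d.
Proof. by rewrite [LHS]tmapE //; exact: mull_linear. Qed.

Fact witt_scaleDr : right_distributive witt_scale +%R.
Proof. by move=> a s t; exact: linD (witt_scale_linear a) s t. Qed.
Fact witt_scaleA a b t : witt_scale a (witt_scale b t) = witt_scale (a * b) t.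
Proof.
elim/tens_ind: t => [c d|s t IHs IHt]; first by rewrite !witt_scaleE mulrA.
by rewrite !witt_scaleDr IHs IHt.
Qed.
Fact witt_scale1 : left_id 1 witt_scale.
Proof.
by elim/tens_ind=> [c d|s t IHs IHt];
  rewrite ?witt_scaleE ?mul1r ?witt_scaleDr ?IHs ?IHt.
Qed.
Fact witt_scaleDl t : {morph witt_scale^~ t : a b / a + b}.
Proof.
move=> a b; elim/tens_ind: t => [c d|s t IHs IHt].
  by rewrite !witt_scaleE mulrDl tensDl.
by rewrite !witt_scaleDr IHs IHt [LHS]addrACA.
Qed.
HB.instance Definition _ := GRing.Zmodule_isLmodule.Build A witt_mod
  witt_scaleA witt_scale1 witt_scaleDr witt_scaleDl.

Lemma restr_witt_scale (k : K) (t : restr witt_mod) :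
  k *: t = (k *: (t : tensor A dspace) : tensor A dspace).
Proof.
change (witt_scale k%:A t = (k *: (t : tensor A dspace) : tensor A dspace)).
elim/tens_ind: t => [v b|s t IHs IHt].
  by rewrite witt_scaleE -scalerAl mul1r tensZl.
by rewrite witt_scaleDr IHs IHt scalerDr.
Qed.

Definition witt_br : tensor A dspace -> tensor A dspace -> tensor A dspace :=
  tlift2 (fun a (d : dspace) b (e : dspace) =>
    tens (a * d b) e - tens (b * e a) d).

Fact witt_quad : quadrilinear (fun a (d : dspace) b (e : dspace) =>
  tens (a * d b) e - tens (b * e a) d).
Proof.
split=> a d; split=> b k u v.
- rewrite dspace_lincomb mulrDr -scalerAr !tensDr tensDl tensZr tensZl.
  by rewrite scalerBr opprD addrACA.
- rewrite (endoP d) mulrDr mulrDl -scalerAr -scalerAl !tensDl !tensZl.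
  by rewrite scalerBr opprD addrACA.
- rewrite dspace_lincomb mulrDr -scalerAr !tensDr tensDl tensZr tensZl.
  by rewrite scalerBr opprD addrACA.
- rewrite (endoP d) mulrDr mulrDl -scalerAr -scalerAl !tensDl !tensZl.
  by rewrite scalerBr opprD addrACA.
Qed.

Lemma witt_brE a (d : dspace) b (e : dspace) :
  witt_br (tens a d) (tens b e) = tens (a * d b) e - tens (b * e a) d.
Proof. exact: tlift2E witt_quad. Qed.

Lemma witt_brDl z : {morph witt_br^~ z : x y / x + y}.
Proof. exact: linD ((tlift2_bilinear witt_quad).2 z). Qed.
Lemma witt_brDr z : {morph witt_br z : x y / x + y}.
Proof. exact: linD ((tlift2_bilinear witt_quad).1 z). Qed.
Lemma witt_brBr z : {morph witt_br z : x y / x - y}.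
Proof. exact: linB ((tlift2_bilinear witt_quad).1 z). Qed.

Definition commuting : Prop :=
  forall d e : der A, d \in Delta -> e \in Delta -> forall a, d (e a) = e (d a).

Hypothesis Delta_comm : commuting.

Let dsC (d e : dspace) a : d (e a) = e (d a).
Proof. by apply: Delta_comm; exact: ds_mem. Qed.

Lemma jacobi_regroup (V : zmodType) (a1 a2 a3 a4 b1 b2 b3 b4 c1 c2 c3 c4 : V) :
  (a1 - a2 - (a3 - a4)) + (b1 - b2 - (b3 - b4)) + (c1 - c2 - (c3 - c4)) =
  (a1 - b3 + (c4 - c2)) + (b1 - c3 + (a4 - a2)) + (c1 - a3 + (b4 - b2)).
Proof.
rewrite !opprB.
by rewrite [LHS](AC ((2*2)*(2*2)*(2*2)) ((1*8*(11*10))*(5*12*(3*2))*(9*4*(7*6)))).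
Qed.

Lemma witt_br_lie0 : is_lie_bracket witt_br.
Proof.
apply: tensor_lie_bracket; first exact: tlift2_bilinear witt_quad.
- by move=> a d b e; rewrite !witt_brE opprB.
- by move=> a d; rewrite witt_brE subrr.
move=> a1 d1 a2 d2 a3 d3 /=.
rewrite !witt_brE !witt_brBr !witt_brE jacobi_regroup.
rewrite -!(tensBl, tensDl) !derM !(dsC d2 d1, dsC d3 d1, dsC d3 d2).
rewrite [X in tens X _]
  (_ : _ = 0); last by ring.
rewrite [X in tens X d1](_ : _ = 0); last by ring.
rewrite [X in tens X d2](_ : _ = 0); last by ring.
by rewrite !tens0l !addr0.
Qed.

Definition witt_lr_br : restr witt_mod -> restr witt_mod -> restr witt_mod :=
  witt_br.

Lemma witt_lr_brP : is_lie_bracket witt_lr_br.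
Proof.
have [[bl br] ba bJ] := witt_br_lie0.
split=> //; split=> x k s t; rewrite !restr_witt_scale; [exact: bl|exact: br].
Qed.

Definition witt_anchor : tensor A dspace -> der A :=
  tlift (fun a (d : dspace) => smul_der a d).

Fact witt_anchor_bilinear : bilinear_map (fun a (d : dspace) => smul_der a d).
Proof.
split=> [a|d] k u v; apply: der_ext => b; rewrite der_lincomb !smul_derE.
  by rewrite dspace_lincomb mulrDr scalerAr.
by rewrite mulrDl scalerAl.
Qed.

Lemma witt_anchorE a (d : dspace) b : witt_anchor (tens a d) b = a * d b.
Proof. by rewrite /witt_anchor tliftE //; exact: witt_anchor_bilinear. Qed.

Let anD : {morph witt_anchor : x y / x + y}.
Proof. exact: linD (tlift_linear witt_anchor_bilinear). Qed.
Let anB : {morph witt_anchor : x y / x - y}.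
Proof. exact: linB (tlift_linear witt_anchor_bilinear). Qed.
Let scD a : {morph (witt_scale a : tensor A dspace -> tensor A dspace) : x y / x + y}.
Proof. exact: linD (witt_scale_linear a). Qed.
Let scB a : {morph (witt_scale a : tensor A dspace -> tensor A dspace) : x y / x - y}.
Proof. exact: linB (witt_scale_linear a). Qed.

Lemma witt_anchor_hom :
  is_lie_hom (L := LieAlg witt_lr_brP) (L' := derLie A) witt_anchor.
Proof.
split=> [k x y|s t].
  by rewrite restr_witt_scale; exact: tlift_linear witt_anchor_bilinear k x y.
have [[dl dr] _ _] := der_br_lie A.
change (witt_anchor (witt_br s t) = der_br (witt_anchor s) (witt_anchor t)).
elim/tens_ind: s t => [a d|s s' IH IH'] t; last first.
  by rewrite witt_brDl !anD IH IH' (linD (dr _)).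
elim/tens_ind: t => [b e|t t' IH IH']; last first.
  by rewrite witt_brDr !anD IH IH' (linD (dl _)).
rewrite witt_brE anB; apply: der_ext => c.
rewrite der_brE derB !witt_anchorE !derM.
by rewrite (dsC e d); ring.
Qed.

Lemma witt_anchor_scale (a : A) (x : witt_mod) b :
  witt_anchor (a *: x) b = a * witt_anchor x b.
Proof.
change (witt_anchor (witt_scale a x) b = a * witt_anchor x b).
elim/tens_ind: x => [c d|s t IH IH']; first by rewrite witt_scaleE !witt_anchorE mulrA.
by rewrite scD !anD !derD IH IH' mulrDr.
Qed.

Lemma witt_leibniz (x y : witt_mod) a :
  witt_lr_br x (a *: y) =
  a *: (witt_lr_br x y : witt_mod) + witt_anchor x a *: y.
Proof.
change (witt_br x (witt_scale a y) =
  witt_scale a (witt_br x y) + witt_scale (witt_anchor x a) y :> tensor A dspace).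
have sDl (t : tensor A dspace) b c :
  witt_scale (b + c) t = witt_scale b t + witt_scale c t :> tensor A dspace.
  exact: witt_scaleDl.
elim/tens_ind: x y => [b d|s s' IH IH'] y; last first.
  by rewrite !witt_brDl IH IH' anD derD sDl scD addrACA.
elim/tens_ind: y => [c e|t t' IH IH']; last first.
  by rewrite !(scD, witt_brDr) IH IH' addrACA.
rewrite !(witt_scaleE, witt_brE) witt_anchorE scB.
rewrite !witt_scaleE [RHS]addrAC -tensDl derM.
by congr (_ - _); congr tens; ring.
Qed.

Definition witt : lieRinehart A :=
  LieRinehart witt_anchor_hom witt_anchor_scale witt_leibniz.

End DerivationSpace.

(* -------------------------------------------------------------------- *)
Lemma morphD0 (U V : zmodType) (f : U -> V) : {morph f : x y / x + y} -> f 0 = 0.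
Proof. by move=> fD; apply: (@addrI _ (f 0)); rewrite -fD !addr0. Qed.

Section WittCrossedHom.
Variables (K : fieldType) (A : comAlgType K) (Delta : submodClosed (der A)).
Hypothesis Delta_comm : commuting Delta.
Variables (n : nat) (e : 'I_n -> dspace Delta).
Hypothesis he : is_basis e.

Local Notation W := (witt Delta_comm).
Local Notation gA := (curLie (glmx K n) A).
Local Notation E i j := (delta_mx i j : 'M[K]_n).

(* Written with coordinates in the basis e; witt_HE below is the formula
   H (sum_i a_i e_i) = sum_i sum_j E_ij (x) e_i(a_j). *)
Definition witt_H_fun : tensor A (dspace Delta) -> gA :=
  tlift (fun a d => \sum_i \sum_j
    tens (bcoord he d 0 j *: E i j : glmx K n) (e i a)).

Fact witt_H_bilinear : bilinear_map (fun (a : A) (d : dspace Delta) =>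
  \sum_i \sum_j tens (bcoord he d 0 j *: E i j : glmx K n) (e i a)).
Proof.
split=> [a|d] k x y; rewrite scaler_sumr -big_split; apply: eq_bigr => i _;
  rewrite /= scaler_sumr -big_split; apply: eq_bigr => j _ /=.
- by rewrite (bcoord_linear he) !mxE scalerDl -scalerA tensDl tensZl.
- by rewrite (endoP (e i)) tensDr tensZr.
Qed.

Lemma witt_H_linear : linear witt_H_fun.
Proof. exact: tlift_linear witt_H_bilinear. Qed.

Lemma witt_H_basis a k :
  witt_H_fun (tens a (e k)) = \sum_i tens (E i k : glmx K n) (e i a).
Proof.
rewrite /witt_H_fun tliftE; last exact: witt_H_bilinear.
apply: eq_bigr => i _; rewrite (bigD1 k) //= bcoord_basis mxE !eqxx scale1r.
by rewrite big1 ?addr0 // => j jk; rewrite mxE (negbTE jk) andbF scale0r tens0l.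
Qed.

Lemma witt_HE (a : 'I_n -> A) :
  witt_H_fun (\sum_i tens (a i) (e i)) =
  \sum_i \sum_j tens (E i j : glmx K n) (e i (a j)).
Proof.
rewrite (lin_sum witt_H_linear) exchange_big /=.
by apply: eq_bigr => j _; rewrite witt_H_basis.
Qed.

Lemma witt_basis_ind (P : tensor A (dspace Delta) -> Prop) :
  P 0 -> (forall a k, P (tens a (e k))) ->
  (forall x y, P x -> P y -> P (x + y)) -> forall x, P x.
Proof.
move=> P0 Pt PD; elim/tens_ind=> // a d; rewrite (bcoordP he d).
elim/big_ind: _ => [|x y Px Py|i _]; first by rewrite tens0r.
- by rewrite tensDr; exact: PD.
- by rewrite tensZr -tensZl.
Qed.

Lemma mx_br_delta (i j k l : 'I_n) : mx_br (E i j) (E k l) =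
  E i l *+ (j == k) - E k j *+ (l == i).
Proof. by rewrite /mx_br !mul_delta_mx_cond. Qed.

Lemma witt_H_crossed (x y : lr_lie W) :
  witt_H_fun (lie_br x y) =
    cur_action W (glmx K n) x (witt_H_fun y)
    - cur_action W (glmx K n) y (witt_H_fun x)
    + lie_br (witt_H_fun x) (witt_H_fun y).
Proof.
have HD : {morph witt_H_fun : x y / x + y} := linD witt_H_linear.
have H0 : witt_H_fun 0 = 0 := lin0 witt_H_linear.
have HB : {morph witt_H_fun : x y / x - y} := linB witt_H_linear.
have [[bl br] _ _] := lie_brP gA.
pose act (z : tensor A (dspace Delta)) : gA -> gA :=
  cur_act_fun (L := W) (g := glmx K n) z.
have aDr z : {morph act z : s t / s + t} := linD (cur_act_linear _).
have aDl u : {morph act^~ u : s t / s + t}.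
  move=> s t; have [al _] := la_hom (cur_action W (glmx K n)).
  by have /(congr1 (fun f : endo _ => f u)) := linD al s t; rewrite endoD.
have actE (a b : A) d (g : glmx K n) :
    act (tens a d) (tens g b) = tens g (a * d b).
  rewrite /act [LHS]cur_actE; congr tens; exact: witt_anchorE.
change (witt_H_fun (witt_br x y) =
  act x (witt_H_fun y) - act y (witt_H_fun x)
  + cur_br (witt_H_fun x) (witt_H_fun y)).
have bDl z : {morph (cur_br (A := A))^~ z : s t / s + t} := linD (br z).
have bDr z : {morph cur_br (A := A) z : s t / s + t} := linD (bl z).
have act_sum z (F : 'I_n -> gA) : act z (\sum_i F i) = \sum_i act z (F i).
  exact: (big_morph _ (aDr z) (morphD0 (aDr z))).
have brE a k b l :
    cur_br (witt_H_fun (tens a (e k))) (witt_H_fun (tens b (e l))) =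
    \sum_i tens (E i l : glmx K n) (e i a * e k b)
    - \sum_i tens (E i k : glmx K n) (e l a * e i b).
  rewrite !witt_H_basis (big_morph _ (bDl _) (morphD0 (bDl _))).
  under eq_bigr => i _ do rewrite (big_morph _ (bDr _) (morphD0 (bDr _))).
  under eq_bigr => i _.
    under eq_bigr => j _ do
      rewrite cur_brE [lie_br _ _]mx_br_delta tensBl.
    rewrite sumrB; over.
  rewrite sumrB; congr (_ - _).
    apply: eq_bigr => i _; rewrite (bigD1 k) //= eqxx big1 ?addr0 // => j jk.
    by rewrite eq_sym (negbTE jk) tens0l.
  rewrite (bigD1 l) //= eqxx [X in _ + X]big1 ?addr0 // => i il.
  by rewrite big1 // => j _; rewrite eq_sym (negbTE il) tens0l.
elim/(witt_basis_ind): x y => [|a k|x x' IH IH'] y.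
- rewrite (morphD0 (witt_brDl y)) !H0 (morphD0 (aDr y)).
  by rewrite (morphD0 (aDl _)) (morphD0 (bDl _)) subrr addr0.
- elim/(witt_basis_ind): y => [|b l|y y' IH IH'].
  + rewrite (morphD0 (witt_brDr _)) !H0 (morphD0 (aDr _)).
    by rewrite (morphD0 (aDl _)) (morphD0 (bDr _)) subrr addr0.
  + rewrite brE witt_brE HB !witt_H_basis !act_sum addrACA -opprD -!big_split.
    congr (_ - _); apply: eq_bigr => i _ /=; rewrite actE -tensDr;
      congr tens; rewrite derM (Delta_comm (ds_mem (e i)) (ds_mem _)); ring.
  + by rewrite witt_brDr HD !(aDl, aDr) IH IH' HD aDr bDr semidirect_addrAC.
- by rewrite witt_brDl HD !(aDl, aDr) IH IH' HD aDr bDl semidirect_addrAC.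
Qed.

Lemma witt_H_linearR : linear (witt_H_fun : lr_lie W -> gA).
Proof.
move=> k x y.
change (k *: x + y) with ((k *: (x : restr (witt_mod Delta)) : restr (witt_mod Delta)) + y).
by rewrite restr_witt_scale; exact: witt_H_linear.
Qed.

Definition witt_H : crossedHom (cur_action W (glmx K n)) :=
  @CrossedHom _ (lr_lie W) gA (cur_action W (glmx K n))
    witt_H_fun witt_H_linearR witt_H_crossed.

End WittCrossedHom.

(* Main.v *)
Require Import Defs.
From mathcomp Require Import all_boot all_order all_algebra.
From mathcomp Require Import reals complex.

Set Implicit Arguments.
Unset Strict Implicit.
Unset Printing Implicit Defensive.

Import GRing.Theory.
Local Open Scope ring_scope.
Local Open Scope complex_scope.

(* The map alpha [+] theta is a representation of the semidirect product,
   because v (x) b |-> v (x) alpha(x) b and v (x) b |-> theta(g) v (x) a b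
   represent the two factors and their commutator is the action of x on
   g (x) a; pulling it back along the Lie homomorphism iota_H gives a
   representation of the Lie-Rinehart algebra.  It is a weak one since the
   first summand satisfies the Leibniz rule and the second is A-linear. *)

(** The crossed homomorphism identity is exactly what the second component of the semidirect bracket
    requires on the graph of [H]. *)
Lemma iota_ch_hom (K : fieldType) (L h : lieAlg K) (act : lieAction L h)
    (H : crossedHom act) : is_lie_hom (iota_ch H).
Proof.
split=> [k x y|x y]; rewrite /iota_ch; first by rewrite (ch_linear H).
by rewrite (ch_crossed H).
Qed.

Lemma is_lie_hom_comp (K : fieldType) (L L' L'' : lieAlg K)
    (g : L' -> L'') (f : L -> L') :
  is_lie_hom g -> is_lie_hom f -> is_lie_hom (g \o f).
Proof.
by move=> [lg bg] [lf bf]; split=> [k x y|x y] /=; rewrite ?lf ?lg ?bf ?bg.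
Qed.

Section ScalarExtension.
Variables (K : fieldType) (A : comAlgType K).

(** [A] multiplies the right factor and [f] acts on the left one. This upgrades the [K]-linearity
    given by [tmap_linear] to the [A]-linearity asked of weak morphisms. *)
Lemma tmap_id_smul (V W : lmodType K) (f : V -> W) (a : A) (t : extmod A V) :
  linear f -> tmap f id (a *: t) = a *: (tmap f id t : extmod A W) :> extmod A W.
Proof.
move=> lf; change (tmap f id (ext_scale a t) = ext_scale a (tmap f id t)).
have lfi : linear (tmap f (@id A)) := tmap_linear lf (@id_linear _ A).
elim/tens_ind: t => [v b|s t IHs IHt].
  by rewrite ext_scaleE !(tmapE _ _ lf (@id_linear _ A)) ext_scaleE.
by rewrite (linD (ext_scale_linear a)) !(linD lfi) IHs IHt
  (linD (ext_scale_linear a)).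
Qed.

Variable g : lieAlg K.
Implicit Types (V W : lieRep g).

Lemma cur_on_ext_linearl V t : linear (fun w : curLie g A => cur_on_ext V w t).
Proof. exact: ((tlift2_bilinear (cur_on_ext_quad A V)).2 t). Qed.

Lemma cur_on_ext_linearr V (w : curLie g A) : linear (cur_on_ext V w).
Proof. exact: ((tlift2_bilinear (cur_on_ext_quad A V)).1 w). Qed.

(** On pure tensors both products of operators carry the same coefficient in [A], by commutativity,
    so only the commutator of the operators on [V] remains. *)
Lemma cur_on_ext_br V (u w : curLie g A) (t : tensor V A) :
  cur_on_ext V (lie_br u w) t =
  cur_on_ext V u (cur_on_ext V w t) - cur_on_ext V w (cur_on_ext V u t).
Proof.
have [_ rbr] := rep_actP V; have [[bl br] _ _] := lie_brP (curLie g A).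
have Cl := fun t => linD (cur_on_ext_linearl (V := V) t).
have Cr := fun w => linD (cur_on_ext_linearr (V := V) w).
elim/tens_ind: u => [x a|u u' IH IH']; last first.
  by rewrite (linD (br w)) !Cl IH IH' Cr opprD addrACA.
elim/tens_ind: w => [y b|w w' IH IH']; last first.
  by rewrite (linD (bl _)) !Cl IH IH' Cr opprD addrACA.
elim/tens_ind: t => [v c|s t IH IH']; last first.
  by rewrite !Cr IH IH' opprD addrACA.
rewrite [lie_br _ _]cur_brE !cur_on_extE rbr endo_brE tensBl !mulrA.
by rewrite [b * a]mulrC.
Qed.

(** On the factor [A] both operations are multiplications, and these commute. *)
Lemma cur_on_ext_smul V (w : curLie g A) (a : A) (t : extmod A V) :
  cur_on_ext V w (a *: t) =
  a *: (cur_on_ext V w t : extmod A V) :> extmod A V.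
Proof.
change (cur_on_ext V w (ext_scale a t) = ext_scale a (cur_on_ext V w t)).
have Cl := fun t => linD (cur_on_ext_linearl (V := V) t).
have Cr := fun w => linD (cur_on_ext_linearr (V := V) w).
have sD := linD (ext_scale_linear (A := A) (V := V) a).
elim/tens_ind: w => [x b|w w' IH IH']; last by rewrite !Cl IH IH' sD.
elim/tens_ind: t => [v c|s t IH IH']; last by rewrite !(sD, Cr) IH IH'.
by rewrite ext_scaleE !cur_on_extE ext_scaleE mulrCA.
Qed.

Lemma cur_on_ext_FHA_mor V W (psi : repHom V W) (w : curLie g A) t :
  FHA_mor psi (cur_on_ext V w t) = cur_on_ext W w (FHA_mor psi t).
Proof.
have lpsi := rh_linear psi; have lid := @id_linear _ A.
have ClV := fun t => linD (cur_on_ext_linearl (V := V) t).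
have ClW := fun t => linD (cur_on_ext_linearl (V := W) t).
have CrV := fun w => linD (cur_on_ext_linearr (V := V) w).
have CrW := fun w => linD (cur_on_ext_linearr (V := W) w).
have mD := linD (tmap_linear lpsi lid).
rewrite /FHA_mor.
elim/tens_ind: w => [x b|w w' IH IH']; last by rewrite ClV ClW mD IH IH'.
elim/tens_ind: t => [v c|s t IH IH']; last by rewrite !(mD, CrV, CrW) IH IH'.
by rewrite cur_on_extE !(tmapE _ _ lpsi lid) cur_on_extE rh_act.
Qed.

Variable L : lieRinehart A.

Definition anchor_on_ext (V : lmodType K) (x : L) : tensor V A -> tensor V A :=
  tmap id (anchor x).

Lemma anchor_on_extE (V : lmodType K) (x : L) (v : V) b :
  anchor_on_ext x (tens v b) = tens v (anchor x b).
Proof. exact: tmapE (@id_linear _ V) (endoP (anchor x)). Qed.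

Lemma anchor_on_ext_linearr (V : lmodType K) (x : L) :
  linear (anchor_on_ext (V := V) x).
Proof. exact: tmap_linear (@id_linear _ V) (endoP (anchor x)). Qed.

Lemma anchor_on_ext_linearl (V : lmodType K) (t : tensor V A) :
  linear (fun x : lr_lie L => anchor_on_ext x t).
Proof.
have [al _] := anchor_hom L; move=> k x y.
elim/tens_ind: t => [v b|s t IHs IHt].
  by rewrite !anchor_on_extE al der_lincomb tensDr tensZr.
by rewrite !(linD (anchor_on_ext_linearr _)) IHs IHt scalerDr addrACA.
Qed.

Lemma anchor_on_ext_br (V : lmodType K) (x y : lr_lie L) (t : tensor V A) :
  anchor_on_ext (lie_br x y : lr_lie L) t =
  anchor_on_ext x (anchor_on_ext y t) - anchor_on_ext y (anchor_on_ext x t).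
Proof.
have [_ abr] := anchor_hom L.
elim/tens_ind: t => [v b|s t IHs IHt].
  by rewrite !anchor_on_extE abr der_brE tensBr.
by rewrite !(linD (anchor_on_ext_linearr _)) IHs IHt opprD addrACA.
Qed.

(** The product rule of the derivation [anchor x]; it is the only source of the anchor term in the
    weak representation axiom. *)
Lemma anchor_on_ext_smul (V : lmodType K) (x : L) (a : A) (t : extmod A V) :
  anchor_on_ext x (a *: t) =
  a *: (anchor_on_ext x t : extmod A V) + anchor x a *: t :> extmod A V.
Proof.
change (anchor_on_ext x (ext_scale a t) =
  ext_scale a (anchor_on_ext x t) + ext_scale (anchor x a) t :> tensor V A).
have sD b := linD (ext_scale_linear (A := A) (V := V) b).
elim/tens_ind: t => [v b|s t IHs IHt].
  by rewrite !(ext_scaleE, anchor_on_extE) derM tensDr addrC.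
by rewrite !(sD, linD (anchor_on_ext_linearr _)) IHs IHt addrACA.
Qed.

Lemma anchor_on_ext_FHA_mor V W (psi : repHom V W) (x : L) t :
  FHA_mor psi (anchor_on_ext x t) = anchor_on_ext x (FHA_mor psi t).
Proof.
have lpsi := rh_linear psi; have lid := @id_linear _ A.
rewrite /FHA_mor; elim/tens_ind: t => [v b|s t IHs IHt].
  by rewrite !(anchor_on_extE, tmapE _ _ lpsi lid).
by rewrite !(linD (anchor_on_ext_linearr _), linD (tmap_linear lpsi lid)) IHs IHt.
Qed.

(** The commutator of a derivation of [A] with multiplication by [a] is multiplication by the
    derivative of [a]. This accounts for the mixed terms of the semidirect bracket. *)
Lemma anchor_on_ext_cur V (x : lr_lie L) (w : curLie g A) (t : tensor V A) :
  anchor_on_ext x (cur_on_ext V w t) - cur_on_ext V w (anchor_on_ext x t) =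
  cur_on_ext V (cur_action L g x w) t.
Proof.
have Cl := fun t => linD (cur_on_ext_linearl (V := V) t).
have Cr := fun w => linD (cur_on_ext_linearr (V := V) w).
have aD := linD (anchor_on_ext_linearr (V := V) x).
elim/tens_ind: w => [y a|w w' IH IH']; last first.
  by rewrite (linD (endoP _)) !Cl aD opprD addrACA IH IH'.
elim/tens_ind: t => [v b|s t IH IH']; last first.
  by rewrite !(aD, Cr) opprD addrACA IH IH'.
rewrite [cur_action _ _ _ _]cur_actE.
by rewrite !(cur_on_extE, anchor_on_extE) derM tensDr addrK.
Qed.

(** Holds by conversion; it moves the sum from the restricted module to [tensor V A], where the
    linearity lemmas of the two summands apply. *)
Lemma boxplus_funE V (p : semidirect (cur_action L g)) (t : tensor V A) :
  boxplus V p t = (anchor_on_ext p.1 t + cur_on_ext V p.2 t : tensor V A).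
Proof. by []. Qed.

Lemma boxplus_hom V :
  is_lie_hom (L' := glLie (restr (extmod A V))) (boxplus (L := L) V).
Proof.
split=> [k p q|p q]; apply: endo_ext => t.
  rewrite endo_lincomb restr_ext_scale !boxplus_funE.
  change (anchor_on_ext (k *: p.1 + q.1 : lr_lie L) t
    + cur_on_ext V (k *: p.2 + q.2) t =
    k *: (anchor_on_ext p.1 t + cur_on_ext V p.2 t)
    + (anchor_on_ext q.1 t + cur_on_ext V q.2 t) :> tensor V A).
  by rewrite anchor_on_ext_linearl cur_on_ext_linearl scalerDr addrACA.
case: p q => [x u] [y w].
rewrite [RHS]endo_brE !boxplus_funE /=.
change (anchor_on_ext (lie_br x y) t
  + cur_on_ext V (cur_action L g x w - cur_action L g y u + lie_br u w) t =
  (anchor_on_ext x (anchor_on_ext y t + cur_on_ext V w t)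
   + cur_on_ext V u (anchor_on_ext y t + cur_on_ext V w t))
  - (anchor_on_ext y (anchor_on_ext x t + cur_on_ext V u t)
   + cur_on_ext V w (anchor_on_ext x t + cur_on_ext V u t)) :> tensor V A).
rewrite anchor_on_ext_br (linD (cur_on_ext_linearl t)) cur_on_ext_br.
rewrite (linB (cur_on_ext_linearl t)) -!anchor_on_ext_cur.
rewrite !(linD (anchor_on_ext_linearr _), linD (cur_on_ext_linearr _)).
rewrite !opprD !opprK.
(* The left side lists eight products commutator by commutator; the permutation regroups them by
   outer operator, in the order [x], [u], [y], [w]. *)
by rewrite [LHS](AC (2*((2*2)*2)) ((1*3)*(6*7)*((2*5)*(4*8)))).
Qed.

Variable H : crossedHom (cur_action L g).

Lemma FHA_act_weak_rep V : is_weak_rep (M := extmod A V) (FHA_act H V).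
Proof.
split; first exact: is_lie_hom_comp (boxplus_hom V) (iota_ch_hom H).
move=> x a t.
change (anchor_on_ext x (a *: t) + cur_on_ext V (H x) (a *: t) =
  a *: ((anchor_on_ext x t : extmod A V) + cur_on_ext V (H x) t)
  + anchor x a *: t :> extmod A V).
(* Moving the term in [anchor x a] next to the anchor summand splits the goal into the Leibniz rule
   for that summand and [A]-linearity of the other. *)
by rewrite scalerDr [RHS]addrAC; congr (_ + _);
  [exact: anchor_on_ext_smul|exact: cur_on_ext_smul].
Qed.

(** Each summand of the action is intertwined separately: the anchor part ignores the left factor,
    and the other part uses that [psi] commutes with the action of [g]. *)
Lemma FHA_mor_weak_hom V W (psi : repHom V W) :
  is_weak_hom (FHA_act H V) (FHA_act H W) (FHA_mor psi : extmod A V -> extmod A W).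
Proof.
have lpsi := rh_linear psi.
have mD := linD (tmap_linear lpsi (@id_linear _ A)).
split=> [a s t|x t].
  rewrite [LHS]mD; congr (_ + _); exact: tmap_id_smul.
rewrite /FHA_act !boxplus_funE [LHS]mD.
by congr (_ + _); [exact: anchor_on_ext_FHA_mor|exact: cur_on_ext_FHA_mor].
Qed.

Lemma FHA_mor_id V : FHA_mor (A := A) (rep_id V) =1 id.
Proof.
apply: tens_eq => [||v b]; [|exact: id_linear|].
  exact: tmap_linear (@id_linear _ V) (@id_linear _ A).
exact: tmapE (@id_linear _ V) (@id_linear _ A).
Qed.

Lemma FHA_mor_comp U V W (f : repHom V W) (h : repHom U V) :
  FHA_mor (A := A) (rep_comp f h) =1 FHA_mor f \o FHA_mor h.
Proof.
have lid := @id_linear _ A.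
have lf := tmap_linear (rh_linear f) lid; have lh := tmap_linear (rh_linear h) lid.
apply: tens_eq => [|k s t|u b] /=.
- exact: tmap_linear (rh_linear (rep_comp f h)) lid.
- by rewrite /FHA_mor lh lf.
- by rewrite /FHA_mor !(tmapE _ _ (rh_linear _) lid).
Qed.

End ScalarExtension.

Theorem corollary4p15 (R : realType) (A : comAlgType R[i])
    (Delta : submodClosed (der A)) (Delta_comm : commuting Delta)
    (Delta_neq0 : exists d : dspace Delta, d != 0)
    (n : nat) (e : 'I_n -> dspace Delta) (e_basis : is_basis e) :
  let W := witt Delta_comm in
  let H := witt_H Delta_comm e_basis in
  exists (Fobj : forall V : lieRep (glmx R[i] n),
            is_weak_rep (L := W) (M := extmod A V) (FHA_act H V))
         (Fmor : forall (V V' : lieRep (glmx R[i] n)) (psi : repHom V V'),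
            is_weak_hom (FHA_act H V) (FHA_act H V') (FHA_mor psi)),
    @is_functor (repCat (glmx R[i] n)) (wrepCat W)
      (fun V => WeakRep (Fobj V))
      (fun V V' psi =>
         @WeakHom _ _ _ (WeakRep (Fobj V)) (WeakRep (Fobj V')) (FHA_mor psi)
           (Fmor V V' psi)).
Proof.
(* The witnesses are only proofs of well-definedness; the modules, actions and maps are already
   fixed by the goal. *)
move=> W H; exists (FHA_act_weak_rep H), (FHA_mor_weak_hom H).
(* Weak morphisms are determined by their underlying functions, so both functor laws reduce to
   pointwise identities. *)
split=> [V|U V V' f h]; apply: weakHom_ext; first exact: FHA_mor_id.
exact: FHA_mor_comp.
Qed.
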